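(* Let $G$ be a graph that is clock-free, diamond-free and has no star cutset. Suppose $a,a',u,v\in V(G)$ are distinct vertices such that $G[\{a,a',u,v\}]$ has edge set exactly $\{aa',av,a'v,uv\}$ (a paw). Then there is a vertex $b\in V(G)\setminus N(a)$ and a clique $K\subseteq N[b]$ such that $\{v\}\cup K$ is disjoint from $\{u,a,a'\}$ and every path in $G$ with one end $u$ and the other end in $\{a,a'\}$ contains a vertex of $\{v\}\cup K$.
   Context: A hole is an induced cycle on at least four vertices; a clock is a hole $C$ together with a vertex $v\notin C$ whose neighbours in $C$ include two non-adjacent vertices; clock-free means no induced clock. A diamond is the four-vertex graph with five edges; diamond-free means no induced diamond. A cutset is a set $X$ with $G\setminus X$ non-empty and disconnected; a star cutset is a cutset $X$ with $X\subseteq N[x]$ for some $x\in X$. $N[b]=N(b)\cup\{b\}$. *)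

(* Defs.v *)
From mathcomp Require Import all_boot.

Set Implicit Arguments.
Unset Strict Implicit.
Unset Printing Implicit Defensive.

(* A finite simple graph is a finType T of vertices together with a symmetric
   and irreflexive adjacency relation e : rel T. *)

Definition nbh (T : finType) (e : rel T) (x : T) : {set T} :=
  [set y | e x y].

Definition closed_nbh (T : finType) (e : rel T) (x : T) : {set T} :=
  x |: nbh e x.

Definition clique (T : finType) (e : rel T) (K : {set T}) : Prop :=
  {in K &, forall x y, x != y -> e x y}.

Definition induced_edges (T : finType) (e : rel T) (S : {set T}) :
    {set {set T}} :=
  [set [set x; y] | x in S, y in S & e x y].

(* The sequence c lists the vertices in cyclic order; the last clause says that
   the cycle is induced. *)
Definition hole (T : finType) (e : rel T) (c : seq T) : Prop :=
  [/\ ucycle e c, 4 <= size c &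
      {in c &, forall x y, e x y -> y = next c x \/ y = prev c x}].

Definition clock (T : finType) (e : rel T) (c : seq T) (v : T) : Prop :=
  [/\ hole e c, v \notin c &
      exists x y, [/\ x \in c, y \in c, x != y & ~~ e x y] /\ (e v x /\ e v y)].

Definition clock_free (T : finType) (e : rel T) : Prop :=
  forall (c : seq T) (v : T), ~ clock e c v.

Definition diamond (T : finType) (e : rel T) (S : {set T}) : Prop :=
  #|S| = 4 /\ #|induced_edges e S| = 5.

Definition diamond_free (T : finType) (e : rel T) : Prop :=
  forall S : {set T}, ~ diamond e S.

Definition connected_on (T : finType) (e : rel T) (S : {set T}) : Prop :=
  {in S &, forall x y, connect [rel z w in S | e z w] x y}.

Definition cutset (T : finType) (e : rel T) (X : {set T}) : Prop :=
  ~: X != set0 /\ ~ connected_on e (~: X).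

Definition star_cutset (T : finType) (e : rel T) (X : {set T}) : Prop :=
  cutset e X /\ exists2 x, x \in X & X \subset closed_nbh e x.

(* The nonempty vertex sequence x :: p is a path of G from x to y; it need not
   be induced. *)
Definition path_from_to (T : finType) (e : rel T) (x y : T) (p : seq T) : Prop :=
  [/\ path e x p, uniq (x :: p) & last x p = y].

(* Main.v *)
(* If a clique K avoiding a and u separates a from u in G - v, then K does the
   job: a' is not in K, since otherwise v + K would be a star cutset centred at
   a', and any vertex of K not adjacent to a, or else a itself, can serve as b.

   Suppose there is no such clique. Then a and u lie in a common set M of
   vertices other than v such that G[M] has no clique cutset. In G[M], for every
   vertex c, each neighbour of c is attached to each component of G[M] - N[c].
   From this, if a hole contains c and t, and r is adjacent to c, then some hole
   contains r and t; as G[M] is connected, every vertex of M lies in a common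
   hole with a. A hole through u and a avoids v, which is adjacent to both, and
   this is a clock. *)

Require Import Defs.
From mathcomp Require Import all_boot.

Set Implicit Arguments.
Unset Strict Implicit.
Unset Printing Implicit Defensive.

(** * Sequences split at one or two entries *)

Lemma next_split (T : eqType) (l1 l2 : seq T) x :
  uniq (l1 ++ x :: l2) -> next (l1 ++ x :: l2) x = head (head x l1) l2.
Proof.
move=> U; have xl1 : x \notin l1.
  by move: U; rewrite cat_uniq /= => /and3P[_ /norP[]].
rewrite next_nth mem_cat mem_head orbT index_cat (negPf xl1) /= eqxx addn0.
(* The default [head x l1] records the cyclic wrap-around: after the last entry comes the first one,
   which is [x] itself when [l1] is empty. *)
case: l1 {U xl1} => [|y l1] /=; first by case: l2.
by rewrite nth_cat ltnNge leqnSn /= subSnn; case: l2.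
Qed.

Lemma mem_split (T : eqType) (x : T) s :
  x \in s -> exists l1 l2, s = l1 ++ x :: l2.
Proof. by case/splitPr => l1 l2; exists l1, l2. Qed.

Lemma mem_split2 (T : eqType) (x y : T) s :
  x \in s -> y \in s -> x != y ->
  (exists l1 l2 l3, s = l1 ++ x :: l2 ++ y :: l3) \/
  (exists l1 l2 l3, s = l1 ++ y :: l2 ++ x :: l3).
Proof.
case/splitPr=> l1 l2; rewrite mem_cat inE orbCA => /orP[/eqP->|]; first by rewrite eqxx.
case/orP=> /mem_split[l [l' ->]] _.
  by right; exists l, l', l2; rewrite -catA.
by left; exists l1, l, l'.
Qed.

Lemma first_split (T : eqType) (P : pred T) s :
  has P s -> exists l1 x l2, [/\ s = l1 ++ x :: l2, P x & ~~ has P l1].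
Proof.
elim: s => //= y s IH; case Py: (P y) => /=; first by exists [::], y, s.
move/IH=> [l1 [x [l2 [-> Px l1P]]]].
by exists (y :: l1), x, l2; rewrite /= Py.
Qed.

Section Graph.
Variables (T : finType) (e : rel T).
Hypotheses (e_sym : symmetric e) (e_irr : irreflexive e).
Implicit Types (S D K M : {set T}) (x y z c r t : T).

(** * Connectivity and components inside a vertex set *)

Definition joined S : rel T := connect [rel z w in S | e z w].

Lemma joined_sym S x y : joined S x y = joined S y x.
Proof.
apply: sym_connect_sym => z w /=.
by rewrite e_sym [(z \in S) && _]andbC.
Qed.

Lemma joined_trans S x y z : joined S x y -> joined S y z -> joined S x z.
Proof. exact: connect_trans. Qed.

Lemma joined_edge S x y : x \in S -> y \in S -> e x y -> joined S x y.
Proof. by move=> xS yS xy; apply: connect1; rewrite /= xS yS. Qed.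

Lemma joinedS S S' x y : S \subset S' -> joined S x y -> joined S' x y.
Proof.
move=> /subsetP sSS'; apply: connect_sub => z w /= /andP[/andP[zS wS] zw].
by apply: joined_edge; rewrite ?sSS'.
Qed.

Lemma joined_path S x p :
  path e x p -> {subset x :: p <= S} -> {in x :: p &, forall y z, joined S y z}.
Proof.
move=> xp sub; suff H y : y \in x :: p -> joined S x y.
  move=> y z /H xy /H xz; apply: joined_trans xz.
  by rewrite joined_sym.
elim: p x xp sub => [|w p IH] x /=.
  by move=> _ _; rewrite inE => /eqP ->; apply: connect0.
move=> /andP[xw wp] sub; rewrite inE => /orP[/eqP->|yp]; first exact: connect0.
apply: joined_trans (IH w wp _ yp); last by move=> z zp; rewrite sub // inE zp orbT.
by apply: joined_edge => //; rewrite sub // !inE eqxx ?orbT.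
Qed.

Lemma joined_sorted S s :
  sorted e s -> {subset s <= S} -> {in s &, forall y z, joined S y z}.
Proof. by case: s => // x p; apply: joined_path. Qed.

Lemma joined_seq x p : path e x p ->
  {in [set y in x :: p] &, forall y z, joined [set y in x :: p] y z}.
Proof.
move=> xp y z; rewrite !in_set; apply: (joined_path xp) => u.
by rewrite in_set.
Qed.

(** As a reflexive closure, [joined S x x] holds even for [x] outside [S]; hence [x \in S] is asked
    for before the path is known to stay in [S]. *)
Lemma joinedP S x y : x \in S -> joined S x y ->
  exists p, [/\ path e x p, {subset x :: p <= S} & last x p = y].
Proof.
move=> xS /connectP[p xp ->]; exists p; split=> //.
  by apply: sub_path xp => z w /= /andP[].
elim: p x xS xp => [|w p IH] x xS /=; first by move=> _ z; rewrite inE => /eqP ->.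
move=> /andP[/andP[/andP[_ wS] _] wp] z; rewrite inE => /orP[/eqP->//|].
exact: IH.
Qed.

Lemma joined_mem S x y : x \in S -> joined S x y -> y \in S.
Proof.
by move=> xS /(joinedP xS)[p [_ sub <-]]; apply: sub; apply: mem_last.
Qed.

Lemma joined_closed S D x y : {in D & S, forall z w, e z w -> w \in D} ->
  x \in S -> joined S x y -> x \in D -> y \in D.
Proof.
move=> clD xS /(joinedP xS)[p [xp sub <-]].
elim: p x {xS} xp sub => [|w p IH] x //= /andP[xw wp] sub xD.
apply: IH => //; first by move=> z zp; rewrite sub // inE zp orbT.
by apply: clD xw => //; rewrite sub // !inE eqxx orbT.
Qed.

(** The empty set qualifies, so non-emptiness is required separately where it matters. *)
Definition component S D :=
  [/\ D \subset S, {in D &, forall y z, joined D y z} &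
      {in D & S, forall y z, e y z -> z \in D}].

Lemma exists_component S x : x \in S ->
  exists2 D, component S D & x \in D.
Proof.
move=> xS; exists [set y | joined S x y]; last by rewrite inE; apply: connect0.
split.
- by apply/subsetP => y; rewrite inE => /(joined_mem xS).
- set D := [set y | _]; suff H y : y \in D -> joined D x y.
    by move=> y z /H xy /H xz; apply: joined_trans xz; rewrite joined_sym.
  rewrite inE => /(joinedP xS)[p [xp sub <-]].
  apply: (joined_path xp); rewrite ?mem_head ?mem_last // => z zp.
  by rewrite inE; apply: (joined_path xp sub); rewrite ?mem_head.
- move=> y z; rewrite !inE => xy zS yz; apply: (joined_trans xy).
  exact: joined_edge (joined_mem xS xy) zS yz.
Qed.

(** * Chordless paths *)

(** Consecutive entries may be adjacent or not; together with [path] this describes an induced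
    path. *)
Definition chordless (s : seq T) := forall l1 x l2 y l3,
  s = l1 ++ x :: l2 ++ y :: l3 -> x != y /\ (l2 != [::] -> ~~ e x y).

Lemma chordless_uniq s : chordless s -> uniq s.
Proof.
elim: s => //= x s IH xs; rewrite IH ?andbT.
  apply/negP => /mem_split[l1 [l2 def_s]].
  by have [] := xs [::] x l1 x l2; rewrite ?def_s ?eqxx.
by move=> l1 y l2 z l3 def_s; apply: (xs (x :: l1) y l2 z l3); rewrite def_s.
Qed.

(** A shortest path from [x] inside [S] to a vertex satisfying [P] works: an earlier vertex
    satisfying [P], a repetition or a chord would give a shorter one. *)
Lemma exists_chordless S (P : pred T) x p :
  path e x p -> {subset x :: p <= S} -> P (last x p) ->
  exists q, [/\ path e x q, {subset x :: q <= S}, P (last x q),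
    {in belast x q, forall w, ~~ P w} & chordless (x :: q)].
Proof.
pose good s := [&& ohead s == Some x, sorted e s, all (mem S) s & P (last x s)].
move=> xp sub Plast.
(* Tuples of a fixed length form a finite type, so a least length can be chosen. *)
have : exists n, [exists s : n.-tuple T, good s].
  exists (size (x :: p)); apply/existsP; exists (in_tuple (x :: p)).
  by rewrite /good /= eqxx xp Plast andbT; apply/(@allP _ (mem S) (x :: p)).
case/ex_minnP=> n /existsP[s0 good_s0] n_min.
have [s good_s min] : exists2 s, good s & forall s', good s' -> size s <= size s'.
  exists s0 => // s' good_s'; rewrite size_tuple; apply: n_min.
  by apply/existsP; exists (in_tuple s').
case: s good_s min => [|y q] // /and4P[/eqP[->] xq /allP sub_q Pq] min.
exists q; split=> //.
  move=> w /mem_split[l1 [l2 def_q]]; apply/negP => Pw.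
  have := min (rcons l1 w); rewrite /good last_rcons Pw.
  have def_xq : x :: q = rcons l1 w ++ rcons l2 (last x q).
    by rewrite lastI def_q rcons_cat cat_rcons.
  have -> : ohead (rcons l1 w) == Some x by case: (l1) def_xq => [|? ?] [->].
  have -> : sorted e (rcons l1 w).
    have : sorted e (x :: q) by [].
    by rewrite def_xq cat_rcons sorted_cat_cons => /andP[].
  rewrite andbT /=; have -> : all (mem S) (rcons l1 w).
    by apply/allP => z zl; apply: sub_q; rewrite def_xq mem_cat zl.
  move/(_ isT); rewrite -[(size q).+1]/(size (x :: q)) def_xq size_cat !size_rcons.
  by rewrite addnS ltnNge leq_addr.
have short l1 w l2 d l3 : x :: q = l1 ++ w :: l2 ++ d :: l3 ->
    (w == d) || (e w d && (l2 != [::])) -> False.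
  move=> def_xq wd.
  (* One shortcut serves both cases: a repetition [w = d] is merged into one entry, and a chord
     replaces the stretch [l2]. *)
  pose s' := l1 ++ w :: (if w == d then l3 else d :: l3).
  have lt_s' : size s' < (size q).+1.
    rewrite -[(size q).+1]/(size (x :: q)) def_xq /s' !size_cat /= size_cat ltn_add2l ltnS.
    case: (w =P d) wd => _ /=; first by rewrite addnS ltnS leq_addl.
    by case/andP=> _; case: (l2) => //= *; rewrite addSn ltnS leq_addl.
  suff /min : good s' by rewrite leqNgt lt_s'.
  have : sorted e (x :: q) by [].
  rewrite /good def_xq sorted_cat_cons => /andP[sl1 wl].
  have dl3 : path e d l3 by move: wl; rewrite cat_path /= => /and3P[].
  apply/and4P; split.
  - by rewrite /s'; case: (l1) def_xq => [|? ?] [-> _].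
  - rewrite /s' sorted_cat_cons sl1 /=.
    by case: (w =P d) wd => [-> /=|_ /= /andP[-> _]].
  - apply/allP => z; rewrite mem_cat inE => zs'; apply: sub_q.
    rewrite def_xq mem_cat inE mem_cat inE.
    move: zs'; case: (w == d); rewrite ?inE;
    by case: (z \in l1); case: (z == w); case: (z \in l2); case: (z == d).
  - have : last x (x :: q) = last x s'.
      rewrite def_xq /s' !last_cat /= last_cat /=.
      by case: (w =P d) => [->|].
    by move=> <-.
move=> l1 w l2 d l3 def_xq; split.
  by apply/negP => /eqP wd; apply: (short _ _ _ _ _ def_xq); rewrite wd eqxx.
move=> l2n; apply/negP => wd; apply: (short _ _ _ _ _ def_xq).
by rewrite wd l2n orbT.
Qed.

Lemma chordless_edge s x y : chordless s -> x \in s -> y \in s -> e x y ->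
  exists l1 l2, s = l1 ++ x :: y :: l2 \/ s = l1 ++ y :: x :: l2.
Proof.
move=> chs xs ys xy; have xDy : x != y by apply: contraTneq xy => ->; rewrite e_irr.
have [[l1 [l2 [l3 def_s]]]|[l1 [l2 [l3 def_s]]]] := mem_split2 xs ys xDy.
  have [_] := chs _ _ _ _ _ def_s; rewrite xy; case: l2 def_s => [|? ?] def_s H.
    by exists l1, l3; left.
  by have := H isT.
have [_] := chs _ _ _ _ _ def_s; rewrite e_sym xy; case: l2 def_s => [|? ?] def_s H.
  by exists l1, l3; right.
by have := H isT.
Qed.

(** * Building a hole from two anticomplete sets *)

Definition anticomplete D1 D2 := {in D1 & D2, forall x y, x != y /\ ~~ e x y}.

(* The hole is made of one chordless path through each of the two sets. *)
Lemma hole_through D1 D2 x y : anticomplete D1 D2 -> x != y -> ~~ e x y ->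
  joined (x |: (y |: D1)) x y -> joined (x |: (y |: D2)) x y ->
  exists C, [/\ hole e C, x \in C /\ y \in C,
    {subset C <= x |: (y |: (D1 :|: D2))},
    exists2 d, d \in D1 & d \in C & exists2 d, d \in D2 & d \in C].
Proof.
move=> ac xDy nxy.
(* The interior [i] is non-empty because [x] and [y] are not adjacent, and it lies in [D] because a
   chordless path meets [x] and [y] only at its ends. *)
have get D : joined (x |: (y |: D)) x y -> exists d i, [/\ path e x (rcons i y),
    {subset i <= D}, d \in i & chordless (x :: rcons i y)].
  move=> /joinedP[|p [xp sub lp]]; first by rewrite setU11.
  have [|q [xq subq /eqP lq _ chq]] := exists_chordless (P := pred1 y) xp sub.
    by rewrite /= lp.
  case/lastP: q xq subq lq chq => [|i z] xq subq /=; first by move=> xy; rewrite xy eqxx in xDy.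
  rewrite last_rcons => def_z; rewrite {}def_z in xq subq *; case: i xq subq => [|d i] xq subq chq.
    by move: xq; rewrite /= (negPf nxy).
  exists d, (d :: i); split; rewrite ?mem_head // => {}z zi; have := chordless_uniq chq.
  rewrite cons_uniq rcons_uniq mem_rcons inE negb_or => /andP[/andP[_ xi] /andP[yi _]].
  have := subq z; rewrite inE mem_rcons inE zi !orbT !inE => /(_ isT) /or3P[/eqP zx|/eqP zy|//].
    by rewrite -zx zi in xi.
  by rewrite -zy zi in yi.
move=> /get[d1 [l1 [xp1 sub1 dl1 ch1]]] /get[d2 [l2 [xp2 sub2 dl2 ch2]]].
pose cyc l l' := x :: l ++ y :: rev l'.
have cycE l l' : cyc l l' = (x :: rcons l y) ++ rev l' by rewrite /cyc cat_cons cat_rcons.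
(* Up to rotation, reversal exchanges the two paths, so it is enough to treat edges on the first
   one. *)
have rev_cyc l l' : rev (cyc l l') = rot 1 (cyc l' l).
  by rewrite /cyc rev_cons rev_cat rev_cons revK rot1_cons cat_rcons.
have U : uniq (cyc l1 l2).
  have := chordless_uniq ch2; rewrite cons_uniq rcons_uniq mem_rcons inE negb_or.
  case/andP=> /andP[_ xl2] /andP[yl2 Ul2].
  rewrite cycE cat_uniq (chordless_uniq ch1) rev_uniq Ul2 andbT /=.
  apply/hasPn => z; rewrite mem_rev => zl2.
  apply/negP => /=; rewrite inE mem_rcons inE => /or3P[/eqP zx|/eqP zy|/sub1 zD1].
  - by rewrite -zx zl2 in xl2.
  - by rewrite -zy zl2 in yl2.
  - by have [] := ac z z zD1 (sub2 z zl2); rewrite eqxx.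
have consec l l' w z : uniq (cyc l l') -> chordless (x :: rcons l y) ->
    w \in x :: rcons l y -> z \in x :: rcons l y -> e w z ->
    z = next (cyc l l') w \/ z = prev (cyc l l') w.
  move=> Ul ch wl zl wz; have [m [m' [def_l|def_l]]] := chordless_edge ch wl zl wz.
    by left; move: Ul; rewrite cycE def_l -catA => Ul; rewrite next_split.
  right; have -> : w = next (cyc l l') z.
    by move: Ul; rewrite cycE def_l -catA => Ul; rewrite next_split.
  by rewrite prev_next.
have mem_cyc z : (z \in cyc l1 l2) = (z \in x :: rcons l1 y) || (z \in x :: rcons l2 y).
  rewrite cycE mem_cat mem_rev !inE !mem_rcons !inE.
  by case: eqP; case: eqP => //=; rewrite ?orbT // orbF.
exists (cyc l1 l2); split.
- split.
  + rewrite /ucycle U andbT /cyc /cycle rcons_cat cat_path /=.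
    move: xp1; rewrite rcons_path => /andP[-> ->] /=.
    have -> : rcons (rev l2) x = rev (belast x (rcons l2 y)).
      by rewrite belast_rcons rev_cons.
    have {1}-> : y = last x (rcons l2 y) by rewrite last_rcons.
    by rewrite rev_path; apply: sub_path xp2 => ? ?; rewrite /= e_sym.
  + rewrite /cyc /= size_cat /= size_rev.
    by case: (l1) dl1 => //; case: (l2) dl2 => //= *; rewrite !addnS.
  + move=> w z; rewrite !mem_cyc => wc zc wz.
    (* No edge joins the two interiors, so both ends of an edge lie on the same path. *)
    have [[wl zl]|[wl zl]] : (w \in x :: rcons l1 y) /\ (z \in x :: rcons l1 y) \/
        (w \in x :: rcons l2 y) /\ (z \in x :: rcons l2 y).
    * have inner l l' d : d \in x :: rcons l y -> d \notin x :: rcons l' y -> d \in l.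
        rewrite !inE !mem_rcons !inE.
        by case: (d == x) => //=; case: (d == y).
      case: (boolP (w \in x :: rcons l1 y)) wc => /= w1 w2;
      case: (boolP (z \in x :: rcons l1 y)) zc => /= z1 z2; [by left| | |by right].
      - case: (boolP (w \in x :: rcons l2 y)) => w3; first by right.
        have [_] := ac w z (sub1 _ (inner _ _ _ w1 w3)) (sub2 _ (inner _ _ _ z2 z1)).
        by rewrite wz.
      - case: (boolP (z \in x :: rcons l2 y)) => z3; first by right.
        have [_] := ac z w (sub1 _ (inner _ _ _ z1 z3)) (sub2 _ (inner _ _ _ w2 w1)).
        by rewrite e_sym wz.
    * exact: consec.
    have U' : uniq (cyc l2 l1).
      by rewrite -(rot_uniq 1) -rev_cyc rev_uniq.
    have := consec l2 l1 w z U' ch2 wl zl wz.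
    rewrite -(next_rot 1 U') -(prev_rot 1 U') -rev_cyc next_rev // prev_rev //.
    by case; [right|left].
- by split; rewrite mem_cyc !inE ?mem_rcons ?inE ?eqxx ?orbT.
- move=> z; rewrite mem_cyc !inE !mem_rcons !inE.
  by case/orP=> [/or3P[->|->|/sub1->]|/or3P[->|->|/sub2->]]; rewrite ?orbT.
- by exists d1; [apply: sub1|rewrite mem_cyc inE mem_rcons inE dl1 !orbT].
- by exists d2; [apply: sub2|rewrite mem_cyc !inE !mem_rcons !inE dl2 !orbT].
Qed.

(** * Chords, rotation and reversal of holes *)

(** As [y] is cyclically next to [x], either nothing lies between them or they are the two ends of
    the sequence, where the order wraps around. *)
Lemma hole_chord C l1 x l2 y l3 : hole e C -> C = l1 ++ x :: l2 ++ y :: l3 ->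
  e x y -> l2 = [::] \/ (l1 = [::] /\ l3 = [::]).
Proof.
case=> /andP[_ U] _ ch def_C xy.
have U1 := U; rewrite def_C in U1.
have U2 := U1; rewrite -cat_cons catA in U2.
have [||def_y|def_y] := ch x y _ _ xy.
- by rewrite def_C mem_cat mem_head orbT.
- by rewrite def_C mem_cat inE mem_cat mem_head !orbT.
- left; move: def_y; rewrite def_C next_split //; case: (l2) U1 => //= w l2' U1 def_y.
  by move: U1; rewrite cat_uniq /= mem_cat -def_y mem_head !orbT !andbF.
right; have /esym : x = next C y by rewrite def_y next_prev.
rewrite def_C -cat_cons catA next_split //.
case: l3 {def_C} U1 U2 => [|w l3] /= U1 U2 def_x.
  case: l1 {U2} U1 def_x => [|w l1] //= U1 def_x.
  by rewrite def_x mem_cat mem_head orbT in U1.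
move: U1; rewrite -def_x cat_uniq /= mem_cat !inE eqxx.
by rewrite !orbT !andbF.
Qed.

Lemma hole_nonadj C l1 x l2 y l3 : hole e C -> C = l1 ++ x :: l2 ++ y :: l3 ->
  l2 != [::] -> (l1 != [::]) || (l3 != [::]) -> x != y /\ ~~ e x y.
Proof.
move=> hC def_C l2n ln; split.
  have [/andP[_ U] _ _] := hC.
  apply: contraTneq U => def_x; rewrite def_C def_x cat_uniq /= mem_cat mem_head orbT.
  by rewrite !andbF.
apply/negP => /(hole_chord hC def_C)[|[l1_0 l3_0]]; first by move/eqP; apply/negP.
by rewrite l1_0 l3_0 in ln.
Qed.

Lemma hole_rot n C : hole e C -> hole e (rot n C).
Proof.
case=> uC sC ch; have [_ U] := andP uC.
split; rewrite ?rot_ucycle ?size_rot // => x y; rewrite !mem_rot next_rot // prev_rot //.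
exact: ch.
Qed.

Lemma hole_rev C : hole e C -> hole e (rev C).
Proof.
case=> /andP[cC U] sC ch; split; rewrite ?size_rev //.
  rewrite /ucycle rev_uniq U andbT rev_cycle.
  by apply: sub_cycle cC => x y; rewrite /= e_sym.
move=> x y; rewrite !mem_rev next_rev // prev_rev // => xC yC /(ch _ _ xC yC).
by case; [right|left].
Qed.

(** Reading the hole backwards from [c] exchanges [z] with [z2], so that arguments for one side of
    [t] carry over to the other. *)
Lemma hole_flip c z m1 t m2 z2 : hole e (c :: z :: m1 ++ t :: rcons m2 z2) ->
  hole e (c :: z2 :: rev m2 ++ t :: rcons (rev m1) z).
Proof.
set s := z :: _; move=> /hole_rev /(hole_rot (size (rev s))).
rewrite rev_cons -cats1 rot_size_cat /= /s rev_cons rev_cat rev_cons rev_rcons.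
by rewrite /= rcons_cat cat_rcons.
Qed.

(** * A hole seen from one of its vertices *)

Section Frame.
Variables (c z z2 t : T) (m1 m2 : seq T).
(** The vertices [z] and [z2] are the neighbours of [c] on the hole, and [t] cuts the rest into [m1]
    and [m2]. *)
Let C := c :: z :: m1 ++ t :: rcons m2 z2.
Hypothesis hC : hole e C.

Lemma frame_path : [/\ e c z, e c z2 & path e z (m1 ++ t :: rcons m2 z2)].
Proof.
have [/andP[+ _] _ _] := hC; rewrite /C /= rcons_path last_cat /= last_rcons.
by rewrite [e z2 c]e_sym => /and3P[-> -> ->].
Qed.

(** The two stretches are kept apart by [t] on one side and by [c] and [z] on the other. *)
Lemma frame_anti : anticomplete [set x in m1] [set x in rcons m2 z2].
Proof.
move=> x y; rewrite !inE => /mem_split[p [p' def_m1]] /mem_split[q [q' def_m2]].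
apply: (hole_nonadj (l1 := c :: z :: p) (l2 := p' ++ t :: q) (l3 := q') hC) => //.
  by rewrite /C def_m1 def_m2 /= -!catA.
by case: (p').
Qed.

Lemma frame_center x : x \in m1 ++ t :: m2 -> x != c /\ ~~ e c x.
Proof.
move=> xm; suff: c != x /\ ~~ e c x by rewrite eq_sym.
have [p [p' def_m]] := mem_split xm.
apply: (hole_nonadj (l1 := [::]) (l2 := z :: p) (l3 := rcons p' z2) hC) => //.
  by rewrite /C -rcons_cons -rcons_cat def_m rcons_cat.
by case: (p').
Qed.

Lemma frame_ends : z != z2 /\ ~~ e z z2.
Proof.
apply: (hole_nonadj (l1 := [:: c]) (l2 := m1 ++ t :: m2) (l3 := [::]) hC) => //.
  by rewrite /C -cats1 -catA.
by case: (m1).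
Qed.
End Frame.

(** * Consequences of clock-freeness *)

Hypothesis e_clock_free : clock_free e.

Lemma clock_center C w x y : hole e C -> w \notin C -> x \in C -> y \in C ->
  x != y -> ~~ e x y -> e w x -> e w y -> False.
Proof.
move=> hC wC xC yC xDy nxy wx wy; apply: (e_clock_free (c := C) (v := w)).
by split=> //; exists x, y.
Qed.

(** [hole_through] yields a hole through [x] and [y] that avoids [w], and [w] would be the centre of
    a clock on it. *)
Lemma no_common_neighbour D1 D2 w x y : anticomplete D1 D2 -> x != y -> ~~ e x y ->
  joined (x |: (y |: D1)) x y -> joined (x |: (y |: D2)) x y ->
  w \notin D1 -> w \notin D2 -> e w x -> e w y -> False.
Proof.
move=> ac xDy nxy j1 j2 wD1 wD2 wx wy.
have [C [hC [xC yC] subC _ _]] := hole_through ac xDy nxy j1 j2.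
apply: (@clock_center C w x y) => //; apply/negP => /subC.
rewrite !inE (negPf wD1) (negPf wD2) !orbF => /orP[] /eqP def_w.
  by rewrite def_w e_irr in wx.
by rewrite def_w e_irr in wy.
Qed.

(** * Attachments and holes in the absence of clique cutsets *)

(** The empty clique is allowed, so this includes connectedness of [M]. *)
Definition no_clique_cutset M :=
  forall K, clique e K -> connected_on e (M :\: K).

Lemma joined_through D x y d d' : {in D &, forall z w, joined D z w} ->
  d \in D -> d' \in D -> e x d -> e y d' -> joined (x |: (y |: D)) x y.
Proof.
move=> Dconn dD d'D xd yd'.
have sD : D \subset x |: (y |: D) by rewrite setUA subsetUr.
apply: (joined_trans (y := d)).
  by apply: joined_edge; rewrite ?setU11 // (subsetP sD).
apply: (joined_trans (y := d')); first exact: joinedS sD (Dconn _ _ dD d'D).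
by apply: joined_edge; [exact: (subsetP sD)|rewrite !inE eqxx orbT|rewrite e_sym].
Qed.

(* If [E], the part cut off from the component [D] by [c] and the neighbours
   of [D], had two non-adjacent neighbours around [c], then [D] and [E] would
   close a hole having [c] as the centre of a clock; hence they form a clique,
   which together with [c] separates [E] from [D]. *)
Lemma component_attached M c D r : no_clique_cutset M ->
  c \in M -> component (M :\: closed_nbh e c) D -> D != set0 ->
  r \in M -> e c r -> exists2 x, x \in D & e x r.
Proof.
move=> ncM cM [DS Dconn Dcl] /set0Pn[d dD] rM cr.
apply/exists_inP; apply: contraT => /exists_inPn nr.
have DNc y : y \in D -> [/\ y \in M, y != c & ~~ e c y].
  by move/(subsetP DS); rewrite !inE negb_or => /andP[/andP[-> ->] ->].
(* If [r] has no neighbour in [D], it survives the removal of [c], [D] and the neighbours of [D]. *)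
pose F := M :\: (c |: (D :|: [set y | [exists x in D, e x y]])).
have rF : r \in F.
  rewrite !inE rM andbT !negb_or; apply/and3P; split.
  - by apply: contraTneq cr => ->; rewrite e_irr.
  - by apply/negP => /DNc[_ _]; rewrite cr.
  - by apply/exists_inPn.
have [E [EF Econn Ecl] rE] := exists_component rF.
have ED x y : x \in E -> y \in D -> x != y /\ ~~ e x y.
  move=> /(subsetP EF); rewrite !inE !negb_or => /andP[/and3P[_ xD /exists_inPn nx] _] yD.
  by rewrite e_sym nx //; split=> //; apply: contraNneq xD => ->.
have cE : c \notin E by apply/negP => /(subsetP EF); rewrite !inE eqxx.
(* These are the attachments of [E] other than [c]. Each has a neighbour in [D], or it would belong
   to [E]; and each is adjacent to [c], or it would belong to [D], which has no edge to [E]. *)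
pose Q := [set q in M | [&& q != c, [exists x in E, e x q] & q \notin E]].
have QP q : q \in Q -> [/\ e c q, exists2 x, x \in D & e x q & exists2 x, x \in E & e x q].
  rewrite inE => /and4P[qM qc /exists_inP[x xE xq] qE].
  have nqD : q \notin D by apply/negP => /(ED x q xE)[_]; rewrite xq.
  have [y yD yq] : exists2 y, y \in D & e y q.
    apply/exists_inP; apply: contraR qE => nyq; apply: Ecl xq => //.
    by rewrite !inE (negPf qc) (negPf nqD) (negPf nyq).
  split; [|by exists y|by exists x].
  apply: contraR nqD => ncq; apply: Dcl yq => //.
  by rewrite !inE (negPf qc) (negPf ncq).
case: (boolP [exists q in Q, [exists q' in Q, (q != q') && ~~ e q q']]).
  case/exists_inP=> q /QP[cq [x xD xq] [w wE wq]].
  case/exists_inP=> q' /QP[cq' [x' x'D xq'] [w' w'E wq']] /andP[qDq' nqq'].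
  case: (@no_common_neighbour E D c q q') => //.
  - by apply: (joined_through Econn wE w'E); rewrite e_sym.
  - by apply: (joined_through Dconn xD x'D); rewrite e_sym.
  - by apply/negP => /DNc[]; rewrite eqxx.
move/exists_inPn => Qcl.
have clK : clique e (c |: Q).
  move=> x y; rewrite !in_setU1 => /orP[/eqP->|xQ] /orP[/eqP->|yQ]; rewrite ?eqxx //.
  - by move=> _; have [] := QP y yQ.
  - by move=> _; rewrite e_sym; have [] := QP x xQ.
  move=> xDy; have /exists_inPn/(_ y yQ) := Qcl x xQ.
  by rewrite xDy negbK.
have dE : d \notin E by apply/negP => /ED/(_ dD)[]; rewrite eqxx.
have rMK : r \in M :\: (c |: Q).
  rewrite !inE rE rM !andbF orbF andbT.
  by apply: contraTneq cr => ->; rewrite e_irr.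
have [dM dc ncd] := DNc d dD.
have dMK : d \in M :\: (c |: Q).
  rewrite in_setD dM andbT in_setU1 negb_or dc.
  by apply/negP => /QP[]; rewrite (negPf ncd).
suff : d \in E by rewrite (negPf dE).
apply: (joined_closed _ rMK) => //; last exact: ncM.
move=> z w zE; rewrite in_setD in_setU1 negb_or => /andP[/andP[wc wQ] wM] zw.
apply: contraT => wE; move: wQ; rewrite inE wM wc wE /= andbT => /exists_inPn/(_ z zE).
by rewrite zw.
Qed.

(** Both [r] and [w] attach to the component of [d] outside the closed neighbourhood of [c], and a
    path from [r] to [w] through that component closes up at [c]. *)
Lemma hole_at_vertex M c d r w : no_clique_cutset M ->
  c \in M -> d \in M -> d != c -> ~~ e c d -> r \in M -> w \in M ->
  e c r -> e c w -> r != w -> ~~ e r w ->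
  exists C, [/\ hole e C, {subset C <= M} & [/\ c \in C, r \in C & w \in C]].
Proof.
move=> ncM cM dM dc ncd rM wM cr cw rDw nrw.
have dS : d \in M :\: closed_nbh e c by rewrite !inE (negPf dc) (negPf ncd).
have [D Dcomp dD] := exists_component dS.
have D0 : D != set0 by apply/set0Pn; exists d.
have [x xD xr] := component_attached ncM cM Dcomp D0 rM cr.
have [y yD yw] := component_attached ncM cM Dcomp D0 wM cw.
have [DS Dconn _] := Dcomp.
have [|||C [hC [rC wC] subC _ [c' + c'C]]] := @hole_through D [set c] r w _ rDw nrw.
- move=> z c' /(subsetP DS); rewrite !inE !negb_or => /andP[/andP[zc ncz] _] /eqP->.
  by rewrite e_sym.
- by apply: (joined_through Dconn xD yD); rewrite e_sym.
- apply: (@joined_through _ _ _ c c); rewrite ?set11 // 1?e_sym //.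
  by move=> z z'; rewrite !inE => /eqP-> /eqP->; apply: connect0.
rewrite inE => /eqP def_c'; rewrite {}def_c' in c'C.
exists C; split=> // z /subC; rewrite !inE => /or4P[/eqP->|/eqP->|zD|/eqP->] //.
by have := subsetP DS z zD; rewrite inE => /andP[].
Qed.

(* Here [z], [c], [z2] are consecutive on a hole whose remaining part is [Y],
   and [s] is a vertex attached to [z] on a chordless path from the neighbour
   [r] of [c] to [Y]. If [r] is adjacent to [z2], then [c] is the centre of a
   clock on a hole through [z] and [z2]; otherwise [z] is the centre of a clock
   on a hole through [c] and [s]. *)
Lemma attachment_clock c z z2 (Y : {set T}) r l1 s l2 :
  z != z2 -> ~~ e z z2 -> e c z -> e c z2 -> e c r -> c \notin Y -> z \notin Y ->
  joined (z |: (z2 |: Y)) z z2 ->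
  path e r (l1 ++ s :: l2) -> chordless (r :: l1 ++ s :: l2) ->
  {in l1 ++ s :: l2, forall x, x != c /\ ~~ e c x} ->
  {in r :: l1 ++ s :: l2, forall x, [/\ x \notin Y, x != z & x != z2]} ->
  {in r :: rcons l1 s & Y, forall x y, ~~ e x y} ->
  {in l1, forall x, ~~ e x z2} -> ~~ e s z2 -> e s z ->
  l2 != [::] -> (exists2 y, y \in Y & e (last s l2) y /\ joined (z2 |: Y) y z2) ->
  False.
Proof.
move=> zDz2 nzz2 cz cz2 cr cY zY zYz2 rp ch pc pY nY l1z2 sz2 sz l2n [y yY [ly yz2]].
have pr : path e r (rcons l1 s) by move: rp; rewrite cat_path rcons_path /= => /and3P[-> ->].
have cDr : c != r by apply: contraTneq cr => ->; rewrite e_irr.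
case: (boolP (e r z2)) => rz2.
  (* One path from [z] to [z2] goes through [s], [l1] and [r], the other through [Y]; [c] is the
     common neighbour. *)
  apply: (@no_common_neighbour [set x in r :: rcons l1 s] Y c z z2) => //.
  - move=> x x'; rewrite inE => xp x'Y; split; last exact: nY.
    have [|xY _ _] := pY x; last by apply: contraNneq xY => ->.
    move: xp; rewrite !inE mem_rcons !mem_cat !inE.
    by case/or3P=> ->; rewrite ?orbT.
  - apply: (@joined_through _ _ _ s r); rewrite 1?e_sym //.
    + exact: joined_seq.
    + by rewrite !inE mem_rcons mem_head orbT.
    + by rewrite !inE eqxx.
  - rewrite !inE mem_rcons inE (negPf cDr) /=; apply/negP => cp.
    have [|] := pc c; last by rewrite eqxx.
    by rewrite mem_cat inE; case/orP: cp => ->; rewrite ?orbT.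
have [sc ncs] : s != c /\ ~~ e c s by apply: pc; rewrite mem_cat mem_head orbT.
have mem_l1 x : x \in r :: l1 -> x \in r :: rcons l1 s.
  by rewrite !inE mem_rcons inE => /orP[]->; rewrite ?orbT.
(* One path from [c] to [s] goes through [r] and [l1], the other through [z2], [Y] and [l2]
   backwards; [z] is the common neighbour. *)
apply: (@no_common_neighbour [set x in r :: l1] ([set x in l2] :|: (z2 |: Y)) z c s) => //.
- move=> x y'; rewrite inE => xl; have xp : x \in r :: l1 ++ s :: l2.
    by rewrite -cat_cons mem_cat xl.
  have [xY xz xz2] := pY x xp; rewrite !inE => /or3P[|/eqP->|y'Y].
  + have [q [q' def_l1]] := mem_split xl; move=> /mem_split[m [m' def_l2]].
    have [] := ch q x (q' ++ s :: m) y' m'.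
      by rewrite -cat_cons def_l1 def_l2 -!catA /= -?catA.
    by move=> -> nxy; split=> //; apply: nxy; case: (q').
  + by split=> //; move: xl; rewrite inE => /orP[/eqP->//|/l1z2].
  + by split; [apply: contraNneq xY => ->|apply: nY => //; apply: mem_l1].
- by rewrite eq_sym.
- apply: (joined_trans (y := r)).
    by apply: joined_edge; rewrite ?inE ?eqxx ?orbT.
  apply: (joined_path pr); rewrite ?mem_head //; last by rewrite inE mem_rcons mem_head orbT.
  by move=> x; rewrite !inE mem_rcons inE => /or3P[]->; rewrite ?orbT.
- apply: (joined_trans (y := z2)).
    by apply: joined_edge; rewrite ?inE ?eqxx ?orbT.
  apply: (joined_trans (y := y)).
    apply: joinedS (_ : z2 |: Y \subset _) _; last by rewrite joined_sym.
    by rewrite !setUA; apply/subsetP => x; rewrite !inE => /orP[]->; rewrite ?orbT.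
  have sl2 : path e s l2 by move: rp; rewrite cat_path => /and3P[].
  rewrite joined_sym; apply: (joined_trans (y := last s l2)).
    apply: (joined_path sl2); rewrite ?mem_head ?mem_last // => x.
    by rewrite !inE => /orP[]->; rewrite ?orbT.
  apply: joined_edge ly; last by rewrite !inE yY !orbT.
  by have := mem_last s l2; rewrite !inE => /orP[]->; rewrite ?orbT.
- by apply/negP; rewrite inE => /mem_l1 zl; have [|] := pY z; rewrite ?eqxx //;
    move: zl; rewrite !inE mem_rcons mem_cat !inE => /or3P[]->; rewrite ?orbT.
- rewrite !inE negb_or; apply/andP; split.
    by apply/negP => zl; have [|] := pY z; rewrite ?eqxx // !(inE, mem_cat) zl !orbT.
  by rewrite negb_or zDz2.
- by rewrite e_sym.
- by rewrite e_sym.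
Qed.

(** * Moving a hole from a vertex to a neighbour of it *)

(** The new hole runs from [r] through [p] and [m1] to [t], and back through [m2], [z2] and [c]. It
    leaves out [z], which is adjacent to [c]. *)
Lemma hole_via_path c z m1 t m2 z2 r p :
  let C := c :: z :: m1 ++ t :: rcons m2 z2 in
  hole e C -> e c r -> path e r p -> 
  {in p, forall x, ~~ e c x} -> {in r :: p, forall x, x \notin C} ->
  ~~ e r t -> {in p & rcons m2 z2, forall x y, ~~ e x y} ->
  p != [::] -> (exists2 y, y \in rcons m1 t & e (last r p) y) ->
  exists C', [/\ hole e C', {subset C' <= [predU C & r :: p]}, r \in C' & t \in C'].
Proof.
move=> C hC cr rp pc pC nrt pm2 pn [y ym1 ly].
have [cz cz2 /path_sorted] := frame_path hC.
rewrite sorted_cat_cons => /andP[sm1 sm2].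
have memC x : (x \in C) = [|| x == c, x == z, x \in m1, x == t | x \in rcons m2 z2].
  by rewrite !inE mem_cat inE.
have rDt : r != t.
  by apply: contraTneq (pC r (mem_head _ _)) => ->; rewrite memC eqxx !orbT.
have lp : last r p \in p by case: (p) pn => //= *; apply: mem_last.
have [|||C' [hC' [rC tC] subC' _ _]] := @hole_through
    ([set x in p] :|: [set x in m1]) (c |: [set x in rcons m2 z2]) r t _ rDt nrt.
- move=> x x'; rewrite in_setU1 !in_setU !in_set => /orP[xp|xm1] /orP[/eqP->|x'm2].
  + rewrite e_sym pc //; split=> //; apply: contraNneq (pC x _) => [->|].
      by rewrite mem_head.
    by rewrite inE xp orbT.
  + split; last exact: pm2.
    apply: contraNneq (pC x _) => [->|]; last by rewrite inE xp orbT.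
    by rewrite memC x'm2 !orbT.
  + by rewrite e_sym; apply: (frame_center hC); rewrite mem_cat xm1.
  + by apply: (frame_anti hC); rewrite inE.
- apply: (joined_trans (y := last r p)).
    apply: (joined_path rp); rewrite ?mem_head ?mem_last // => x.
    by rewrite !inE => /orP[]->; rewrite ?orbT.
  have sub1 : {subset rcons m1 t <= r |: (t |: ([set x in p] :|: [set x in m1]))}.
    by move=> x; rewrite mem_rcons !inE => /orP[]->; rewrite ?orbT.
  apply: (joined_trans (y := y)).
    by apply: joined_edge ly; [rewrite !inE lp !orbT|exact: sub1].
  by apply: (joined_sorted sm1) => //; rewrite mem_rcons mem_head.
- have sub2 : {subset t :: rcons m2 z2 <= r |: (t |: (c |: [set x in rcons m2 z2]))}.
    by move=> x; rewrite !inE => /orP[]->; rewrite ?orbT.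
  apply: (joined_trans (y := c)).
    by apply: joined_edge; rewrite ?inE ?eqxx ?orbT // e_sym.
  have z2m : z2 \in t :: rcons m2 z2 by rewrite inE mem_rcons mem_head orbT.
  apply: (joined_trans (y := z2)).
    by apply: joined_edge cz2; [rewrite !inE eqxx !orbT|exact: sub2].
  by apply: (joined_path sm2); rewrite ?mem_head.
exists C'; split=> // x; have -> : (x \in [predU C & r :: p]) = (x \in C) || (x \in r :: p) by [].
move/subC'; rewrite memC !inE.
by case/or4P=> [->|->|/orP[]->|/orP[]->]; rewrite ?orbT.
Qed.

Lemma hole_rot_to C c : hole e C -> c \in C ->
  exists i z m1 t m2 z2, rot i C = c :: z :: m1 ++ t :: rcons m2 z2.
Proof.
move=> [_ + _] cC; have [i s def_C] := rot_to cC.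
rewrite -(size_rot i) def_C; case: s def_C => [|z s] //.
case/lastP: s => [|[|t m2] z2] // def_C _.
by exists i, z, [::], t, m2, z2.
Qed.

Lemma hole_split_at c z m1 t m2 z2 x : let m := m1 ++ t :: m2 in
  x \in c :: z :: m1 ++ t :: rcons m2 z2 ->
  [\/ x = c, x = z, x = z2 | x \in m].
Proof.
move=> m; rewrite /m !inE !mem_cat !inE mem_rcons inE.
by case/or4P=> [/eqP|/eqP|->|/or3P[->|/eqP|->]]; rewrite ?orbT; constructor.
Qed.

(** A hole through [c] supplies the non-neighbour of [c] that [hole_at_vertex] asks for. *)
Lemma hole_with_neighbours M C c r w : no_clique_cutset M -> hole e C ->
  {subset C <= M} -> c \in C -> w \in C -> e c w -> r \in M -> r \notin C ->
  e c r -> ~~ e r w ->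
  exists C', [/\ hole e C', {subset C' <= M} & [/\ c \in C', r \in C' & w \in C']].
Proof.
move=> ncM hC subC cC wC cw rM rC cr nrw.
have [i [z [m1 [t [m2 [z2 def_C]]]]]] := hole_rot_to hC cC.
have hF : hole e (rot i C) by apply: hole_rot.
rewrite def_C in hF.
have [|tc nct] := @frame_center _ _ _ _ _ _ hF t; first by rewrite mem_cat mem_head orbT.
have tM : t \in M.
  by apply: subC; rewrite -(mem_rot i) def_C !(inE, mem_cat) eqxx !orbT.
apply: hole_at_vertex tM tc nct _ _ _ _ _ _ => //; try exact: subC.
by apply: contraNneq rC => ->.
Qed.

(** One of the two neighbours of [c] on the hole is not adjacent to [r], as otherwise [r] would be
    the centre of a clock; it serves as [w] in [hole_with_neighbours]. *)
Lemma hole_edge M C c r : no_clique_cutset M -> hole e C -> {subset C <= M} ->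
  c \in C -> r \in M -> r \notin C -> e c r ->
  exists C', [/\ hole e C', {subset C' <= M}, r \in C' & c \in C'].
Proof.
move=> ncM hC subC cC rM rC cr.
suff [w [wC cw nrw]] : exists w, [/\ w \in C, e c w & ~~ e r w].
  have [C' [? ? []]] := hole_with_neighbours ncM hC subC cC wC cw rM rC cr nrw.
  by exists C'.
have [i [z [m1 [t [m2 [z2 def_C]]]]]] := hole_rot_to hC cC.
have hF : hole e (rot i C) by apply: hole_rot.
rewrite def_C in hF.
have zC : z \in C by rewrite -(mem_rot i) def_C !inE eqxx orbT.
have z2C : z2 \in C by rewrite -(mem_rot i) def_C !(inE, mem_cat, mem_rcons) eqxx !orbT.
have [cz cz2 _] := frame_path hF; have [zDz2 nzz2] := frame_ends hF.
case: (boolP (e r z)) => rz; last by exists z.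
exists z2; split=> //; apply/negP => rz2.
exact: (clock_center hC rC zC z2C).
Qed.

Lemma joined_frame c z m1 t m2 z2 (Y := [set x in m1 ++ t :: m2]) :
  hole e (c :: z :: m1 ++ t :: rcons m2 z2) ->
  {in Y, forall y, joined (z2 |: Y) y z2} /\ joined (z |: (z2 |: Y)) z z2.
Proof.
move=> hC; have [_ _ zp] := frame_path hC.
have zp' : path e z (rcons (m1 ++ t :: m2) z2) by rewrite rcons_cat.
have sm := path_sorted zp'; split.
- move=> y; rewrite in_set => ym.
  apply: (joined_sorted sm); rewrite ?mem_rcons ?mem_head // ?inE ?ym ?orbT //.
  by move=> x; rewrite mem_rcons in_cons in_setU1 in_set.
- apply: (joined_path zp'); rewrite ?mem_head //; last by rewrite inE mem_rcons mem_head orbT.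
  by move=> x; rewrite in_cons mem_rcons in_cons !in_setU1 in_set.
Qed.

(* Follow a chordless path from [r], outside the closed neighbourhood of [c], to
   the rest of the hole. By [attachment_clock] only its last vertex sees the
   hole apart from [r], and this vertex sees the hole on one side of [t] only. *)
Lemma hole_rotate_middle M c z m1 t m2 z2 r :
  let C := c :: z :: m1 ++ t :: rcons m2 z2 in
  no_clique_cutset M -> hole e C -> {subset C <= M} ->
  r \in M -> r \notin C -> e c r ->
  exists C', [/\ hole e C', {subset C' <= M}, r \in C' & t \in C'].
Proof.
move=> C ncM hC subC rM rC cr; set m := m1 ++ t :: m2.
have hC2 := hole_flip hC; set C2 := c :: _ in hC2.
have memC x : (x \in C) = [|| x == c, x == z, x == z2 | x \in m].
  rewrite !inE !mem_cat !inE mem_rcons inE.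
  by case: (x == z2); case: (x \in m1); case: (x == t); rewrite ?orbT.
have mem2 x : (x \in rev m2 ++ t :: rev m1) = (x \in m).
  rewrite /m !mem_cat !inE !mem_rev.
  by case: (x \in m1); case: (x == t); rewrite ?orbT ?orbF.
have [cz cz2 _] := frame_path hC; have [zDz2 nzz2] := frame_ends hC.
have mc x : x \in m -> x != c /\ ~~ e c x by exact: (frame_center hC).
have tm : t \in m by rewrite mem_cat mem_head orbT.
have [tc nct] := mc t tm.
have cC : c \in C := mem_head _ _.
have zC : z \in C by rewrite memC eqxx orbT.
have z2C : z2 \in C by rewrite memC eqxx !orbT.
have mC x : x \in m -> x \in C by move=> xm; rewrite memC xm !orbT.
have star w x y : w \notin C -> x \in C -> y \in C -> x != y -> ~~ e x y ->
  e w x -> ~~ e w y.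
  by move=> wC xC yC xy nxy wx; apply/negP => wy; apply: (clock_center hC wC xC yC).
have rm x : x \in m -> ~~ e r x.
  move=> xm; have [xc ncx] := mc x xm; apply: (star r c x) => //; try exact: mC.
    by rewrite eq_sym.
  by rewrite e_sym.
have tS : t \in M :\: closed_nbh e c.
  by rewrite !inE (negPf tc) (negPf nct) subC // mC.
have [D Dcomp tD] := exists_component tS; have [DS Dconn _] := Dcomp.
have [|x xD xr] := component_attached ncM (subC c cC) Dcomp _ rM cr.
  by apply/set0Pn; exists t.
have DP y : y \in D -> [/\ y \in M, y != c & ~~ e c y].
  by move/(subsetP DS); rewrite !inE negb_or => /andP[/andP[-> ->] ->].
pose P w := [exists y in m, e w y].
(* Take a path inside [D] from a neighbour of [r] to [t] and drop its last vertex [t]. Something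
   remains, since [r] is not adjacent to [t]. *)
have [p0 [rp0 subp0 Pp0]] : exists p, [/\ path e r p, {subset r :: p <= r |: D} & P (last r p)].
  have [p [xp subp lp]] := joinedP xD (Dconn x t xD tD).
  case/lastP: p xp subp lp => [|p t'] xp subp; rewrite /= ?last_rcons => def_t.
    by have := rm t tm; rewrite -def_t e_sym xr.
  exists (x :: p); move: xp; rewrite rcons_path def_t => /andP[xp lt].
  split=> //=; [by rewrite e_sym xr| |by apply/exists_inP; exists t].
  move=> y; rewrite in_setU1 in_cons => /orP[->//|yp].
  by rewrite subp ?orbT // -rcons_cons mem_rcons in_cons yp orbT.
have [p [rp subp Pp nPp ch]] := exists_chordless rp0 subp0 Pp0.
have pn : p != [::].
  by apply/eqP => p0E; move: Pp; rewrite p0E => /exists_inP[y /rm nry]; apply/negP.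
have pD y : y \in p -> y \in D.
  move=> yp; have := chordless_uniq ch => /= /andP[rp' _].
  have := subp y; rewrite !inE yp orbT => /(_ isT) /orP[/eqP yr|//].
  by rewrite -yr yp in rp'.
have pc y : y \in p -> y != c /\ ~~ e c y by move/pD/DP => [].
have pm y : y \in p -> y \notin m.
  move=> yp; apply/negP => ym; have [l1 [l2 def_p]] := mem_split yp.
  have /nPp/negP : last r l1 \in belast r p.
    by rewrite def_p belast_cat /= mem_cat mem_head orbT.
  case; apply/exists_inP; exists y => //.
  by move: rp; rewrite def_p cat_path => /= /and3P[].
have pC y : y \in r :: p -> y \notin C.
  rewrite inE => /orP[/eqP->//|yp]; have [yc ncy] := pc y yp.
  rewrite memC (negPf yc) (negPf (pm y yp)) orbF /=.
  by apply/norP; split; apply: contraNneq ncy => ->.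
have nrt := rm t tm.
have /exists_inP[y ym ly] := Pp.
have lp : last r p \in p by case: (p) pn => //= *; apply: mem_last.
have nm : {in belast r p & m, forall w y, ~~ e w y}.
  by move=> w y' wp y'm; have /exists_inPn/(_ y' y'm) := nPp w wp.
have [Yz2 zYz2] := joined_frame hC; have [Yz z2Yz] := joined_frame hC2.
have eqY : [set x in rev m2 ++ t :: rev m1] = [set x in m].
  by apply/setP => w; rewrite !in_set mem2.
rewrite eqY in Yz z2Yz.
have mY w : w \in m -> w \in [set x in m] by rewrite in_set.
(* [attachment_clock] is applied to the hole and to its mirror image, which excludes [z] and [z2] in
   turn. *)
have free s l1 l2 : p = l1 ++ s :: l2 -> l2 != [::] ->
    {in l1, forall w, ~~ (e w z || e w z2)} -> ~~ (e s z || e s z2).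
  move=> def_p l2n nl1; have sp : s \in p by rewrite def_p mem_cat mem_head orbT.
  have sC : s \notin C by rewrite pC // inE sp orbT.
  have sub_last : {subset r :: rcons l1 s <= belast r p}.
    move=> w wl; rewrite def_p -cat_rcons belast_cat mem_cat.
    case/lastP: (l2) l2n => // l2' d _; rewrite !belast_rcons last_rcons.
    move: wl; rewrite -rcons_cons mem_rcons in_cons => /orP[/eqP->|->] //.
    by rewrite mem_head orbT.
  have nY : {in r :: rcons l1 s & [set x in m], forall x y, ~~ e x y}.
    by move=> w y' /sub_last wp; rewrite in_set; apply: nm.
  have cY : c \notin [set x in m] by rewrite in_set; apply/negP => /mc[]; rewrite eqxx.
  have pY w : w \in r :: p -> [/\ w \notin [set x in m], w != z & w != z2].
    move=> /pC wC; rewrite in_set; split=> //; first by apply: contraNN wC => /mC.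
      by apply: contraNN wC => /eqP->.
    by apply: contraNN wC => /eqP->.
  have zm : z \notin [set x in m].
    by rewrite in_set; apply/negP => /mc[_]; rewrite cz.
  have z2m : z2 \notin [set x in m].
    by rewrite in_set; apply/negP => /mc[_]; rewrite cz2.
  have lastE : last s l2 = last r p by rewrite def_p last_cat.
  apply/norP; split; apply/negP => sz.
    apply: (@attachment_clock c z z2 [set x in m] r l1 s l2) => //; rewrite -?def_p //.
    - by move=> w /nl1 /norP[].
    - exact: star sC zC z2C _ _ sz.
    - by exists y; rewrite ?mY // lastE; split=> //; apply: Yz2; apply: mY.
  apply: (@attachment_clock c z2 z [set x in m] r l1 s l2) => //; rewrite -?def_p //.
  - by rewrite eq_sym.
  - by rewrite e_sym.
  - by move=> w /pY[].
  - by move=> w /nl1 /norP[].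
  - by apply: (star _ z2 z) => //; rewrite 1?eq_sym 1?e_sym.
  - by exists y; rewrite ?mY // lastE; split=> //; apply: Yz; apply: mY.
(* Otherwise [free] applies to the first vertex of the path that sees [z] or [z2]. *)
have free_all l1 s l2 : p = l1 ++ s :: l2 -> l2 != [::] -> ~~ (e s z || e s z2).
  move=> def_p l2n; apply/negP => sz.
  have hl : has (fun w => e w z || e w z2) (rcons l1 s) by rewrite has_rcons sz.
  have [q [w [q' [def_l wz nq]]]] := first_split hl.
  have := free w q (q' ++ l2); rewrite wz; case/(_ _ _ _)/negP => //.
  - by rewrite def_p -cat_rcons def_l -catA.
  - by case: (q') => //=; case: (l2) l2n.
  - by apply/hasPn.
have not_last w : w \in p -> w != last r p -> exists l1 l2, p = l1 ++ w :: l2 /\ l2 != [::].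
  move=> wp wl; have [l1 [l2 def_p]] := mem_split wp; exists l1, l2; split=> //.
  by apply: contraNneq wl => l2_0; rewrite def_p l2_0 cats1 last_rcons.
have inner w : w \in p -> w != last r p -> forall y', y' \in C -> ~~ e w y'.
  move=> wp wl y'; have [l1 [l2 [def_p l2n]]] := not_last w wp wl.
  have /norP[nz nz2] := free_all _ _ _ def_p l2n.
  have wb : w \in belast r p.
    have : w \in rcons (belast r p) (last r p) by rewrite -lastI inE wp orbT.
    by rewrite mem_rcons inE (negPf wl).
  rewrite memC => /or4P[/eqP->|/eqP->|/eqP->|y'm] //; last exact: nm.
  by rewrite e_sym; have [] := pc w wp.
have lC : last r p \notin C by apply: pC; apply: mem_last.
have memC2 w : (w \in C2) = (w \in C).
  rewrite memC !inE !mem_cat !inE !mem_rcons !inE !mem_rev.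
  by case: (w == z); case: (w == z2); case: (w \in m1); case: (w == t); rewrite ?orbT ?orbF.
have inM C' : {subset C' <= [predU C & r :: p]} -> {subset C' <= M}.
  move=> subC' w /subC'; rewrite inE /= => /orP[/subC//|].
  by rewrite inE => /orP[/eqP->//|/pD/DP[]].
have m2C w : w \in rcons m2 z2 -> w \in C.
  by rewrite mem_rcons inE => /orP[/eqP->//|wm]; rewrite mC // mem_cat inE wm !orbT.
have pc' w : w \in p -> ~~ e c w by case/pc.
(* If the last vertex sees the side of [z2], clock-freeness keeps it from seeing [z] or [m1], and
   the mirrored hole is rerouted; otherwise the hole itself is. *)
case: (boolP (has (e (last r p)) (rcons m2 z2))) => [/hasP[y' y'm2 ly']|/hasPn nl].
  have nlz : {in rcons (rev m1) z, forall w, ~~ e (last r p) w}.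
    move=> w wm1; have wC : w \in C.
      by move: wm1; rewrite mem_rcons inE mem_rev => /orP[/eqP->//|wm]; rewrite mC // mem_cat wm.
    apply: (star _ y' w) => //; first exact: m2C.
      move: wm1 y'm2; rewrite !mem_rcons !inE mem_rev => /orP[/eqP->|wm1] y'm2.
        case/orP: y'm2 => [/eqP->|y'm2]; first by rewrite eq_sym.
        have [] := frame_anti hC2 (x := y') (y := z); rewrite ?inE ?mem_rev //.
        by rewrite mem_rcons mem_head.
      have [] := frame_anti hC (x := w) (y := y'); rewrite ?inE ?mem_rcons //.
      by rewrite eq_sym.
    move: wm1 y'm2; rewrite !mem_rcons !inE mem_rev => /orP[/eqP->|wm1] y'm2.
      case/orP: y'm2 => [/eqP->|y'm2]; first by rewrite e_sym.
      have [] := frame_anti hC2 (x := y') (y := z); rewrite ?inE ?mem_rev //.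
      by rewrite mem_rcons mem_head.
    have [] := frame_anti hC (x := w) (y := y'); rewrite ?inE ?mem_rcons //.
    by rewrite e_sym.
  have [|||C' [hC' subC' rC' tC']] := hole_via_path hC2 cr rp pc' _ nrt _ pn.
  - by move=> w wp; rewrite memC2 pC.
  - move=> w w' wp w'm; case: (w =P last r p) => [->|/eqP wl]; first exact: nlz.
    apply: inner => //; move: w'm; rewrite mem_rcons inE mem_rev => /orP[/eqP->//|w'm].
    by rewrite mC // mem_cat w'm.
  - exists y => //; rewrite mem_rcons inE mem_rev.
    move: ym; rewrite mem_cat inE => /or3P[ym|->//|->]; rewrite ?orbT //.
    by have := nlz y; rewrite mem_rcons inE mem_rev ym orbT ly => /(_ isT).
  exists C'; split=> //; apply: inM => w /subC' /orP[wC2|wp]; apply/orP; [left|by right].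
  by have : w \in C2 := wC2; rewrite memC2.
have [||C' [hC' subC' rC' tC']] := hole_via_path hC cr rp pc' pC nrt _ pn.
- move=> w w' wp w'm; case: (w =P last r p) => [->|/eqP wl]; first exact: nl.
  by apply: inner => //; apply: m2C.
- exists y => //; rewrite mem_rcons inE.
  move: ym; rewrite mem_cat inE => /or3P[->|->|ym]; rewrite ?orbT //.
  by have := nl y; rewrite mem_rcons inE ym orbT ly => /(_ isT).
by exists C'; split=> //; apply: inM.
Qed.

(** The cases follow the position of [t] on the hole: at [c], next to [c], or further away. *)
Lemma hole_rotate M C c t r : no_clique_cutset M -> hole e C -> {subset C <= M} ->
  c \in C -> t \in C -> r \in M -> e c r ->
  exists C', [/\ hole e C', {subset C' <= M}, r \in C' & t \in C'].
Proof.
move=> ncM hC subC cC tC rM cr.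
case: (boolP (r \in C)) => [rC|rC]; first by exists C.
have [i [z [m1 [t0 [m2 [z2 def_C]]]]]] := hole_rot_to hC cC.
have hF : hole e (rot i C) by apply: hole_rot.
have end_case w : w \in C -> e c w ->
    exists C', [/\ hole e C', {subset C' <= M}, r \in C' & w \in C'].
  move=> wC cw; case: (boolP (e r w)) => rw.
    by apply: hole_edge hC subC wC rM rC _; rewrite // e_sym.
  have [C' [? ? []]] := hole_with_neighbours ncM hC subC cC wC cw rM rC cr rw.
  by exists C'.
move: (tC); rewrite -(mem_rot i) def_C; have [cz cz2 _] : [/\ e c z, e c z2 & true].
  by move: hF; rewrite def_C => /frame_path[].
case/hole_split_at => [->|tz|tz2|].
- exact: hole_edge hC subC cC rM rC cr.
- by apply: end_case => //; rewrite tz.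
- by apply: end_case => //; rewrite tz2.
(* The rest of the hole is split anew, at the given [t] instead of the arbitrary [t0]. *)
move=> /mem_split[q1 [q2 def_m]].
have def_C' : rot i C = c :: z :: q1 ++ t :: rcons q2 z2.
  by rewrite def_C -rcons_cons -rcons_cat def_m rcons_cat.
rewrite def_C' in hF; apply: hole_rotate_middle hF _ rM _ cr => //.
  by move=> w; rewrite -def_C' mem_rot; apply: subC.
by rewrite -def_C' mem_rot.
Qed.

Lemma common_hole M a u : no_clique_cutset M -> a \in M -> u \in M -> a != u ->
  ~~ e a u -> exists C, [/\ hole e C, {subset C <= M}, u \in C & a \in C].
Proof.
move=> ncM aM uM aDu nau.
pose N := [set x in M | e a x].
have aMN : a \in M :\: N by rewrite !inE e_irr aM andbF.
have uMN : u \in M :\: N by rewrite !inE (negPf nau) uM andbF.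
(* The neighbours of [a] in [M] separate [a] from [u], so they are not a clique, and two
   non-adjacent ones give a first hole through [a]. *)
have [C [hC subC aC]] : exists C, [/\ hole e C, {subset C <= M} & a \in C].
  case: (boolP [exists x in N, [exists y in N, (x != y) && ~~ e x y]]).
    case/exists_inP=> x; rewrite inE => /andP[xM ax].
    case/exists_inP=> y; rewrite inE => /andP[yM ay] /andP[xDy nxy].
    have [|C [hC subC [aC _ _]]] := hole_at_vertex ncM aM uM _ nau xM yM ax ay xDy nxy.
      by rewrite eq_sym.
    by exists C.
  move/exists_inPn => Ncl; have clN : clique e N.
    by move=> x y xN yN xDy; have /exists_inPn/(_ y yN) := Ncl x xN; rewrite xDy negbK.
  have := @joined_closed (M :\: N) [set a] a u _ aMN (ncM _ clN _ _ aMN uMN) (set11 a).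
  rewrite inE eq_sym (negPf aDu) => H; suff: false by []; apply: H.
  move=> x y; rewrite inE => /eqP->; rewrite !inE => /andP[+ yM] ay.
  by rewrite yM ay.
have au : joined M a u.
  by have := ncM set0 _ a u; rewrite setD0; apply=> // x y; rewrite inE.
have [p [ap subp <-]] := joinedP aM au.
have : exists C', [/\ hole e C', {subset C' <= M}, a \in C' & a \in C'] by exists C.
(* Only the start of the path is generalised: [x] advances towards [u] while [a] stays on every
   hole. *)
elim: p {1 2 3 5}a ap subp {au} => [|w p IH] x //= /andP[xw wp] subp [C' [hC' subC' xC' aC']].
apply: IH => //; first by move=> y yp; apply: subp; rewrite inE yp orbT.
by apply: hole_rotate hC' subC' xC' aC' _ xw => //; apply: subp; rewrite !inE eqxx orbT.
Qed.

(** * Reduction to a set without clique cutset *)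

Definition cliqueb K := [forall x in K, forall y in K, (x != y) ==> e x y].

Lemma cliqueP K : reflect (clique e K) (cliqueb K).
Proof.
apply: (iffP forall_inP) => [clK x y xK yK|clK x xK].
  by have /forall_inP/(_ y yK)/implyP := clK x xK.
by apply/forall_inP => y yK; apply/implyP; apply: clK.
Qed.

Definition clique_linked M a u := forall K, clique e K -> a \notin K -> u \notin K ->
  joined (M :\: K) a u.

(* A chordless path leaving the set through [K] cannot come back, since its exit
   and its entry would be adjacent vertices of [K]. *)
Lemma clique_linked_sub M K F a u : clique e K -> component (M :\: K) F ->
  a \in (K :&: M) :|: F -> u \in (K :&: M) :|: F ->
  clique_linked M a u -> clique_linked ((K :&: M) :|: F) a u.
Proof.
move=> clK [FS Fconn Fcl]; set M' := _ :|: F => aM' uM' linkM L clL aL uL.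
have M'M : M' \subset M.
  by rewrite subUset subsetIr (subset_trans FS) // subsetDl.
have aML : a \in M :\: L by rewrite inE aL (subsetP M'M).
have [p [ap subp /eqP lp]] := joinedP aML (linkM L clL aL uL).
have [q [aq subq /eqP lq _ ch]] := exists_chordless (P := pred1 u) ap subp lp.
(* Since [F] is a component of [M :\: K], the path can cross between [M'] and the rest of [M] only
   in [K]. *)
have side s w b : sorted e s -> {subset s <= a :: q} -> w \in s -> b \in s ->
    b \in M' -> w \notin M' -> has (mem K) s.
  move=> ss sq ws bs bM' wM'; apply: contraNT wM' => /hasPn nK.
  have sMK : {subset s <= M :\: K}.
    move=> x xs; have := subq x (sq x xs); rewrite !inE => /andP[_ ->].
    by rewrite andbT; apply: nK.
  rewrite inE; apply/orP; right.
  apply: (joined_closed Fcl (sMK b bs)); first exact: (joined_sorted ss sMK).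
  have bK : b \notin K by apply: nK.
  by move: bM'; rewrite !inE (negPf bK).
suff subM' : {subset a :: q <= M' :\: L}.
  have uq : u \in a :: q by rewrite -lq mem_last.
  by apply: (joined_path aq subM') => //; apply: mem_head.
move=> w wq; have := subq w wq; rewrite !in_setD => /andP[-> wM] /=.
apply: contraT => wM'.
have [l1 [l2 def_q]] := mem_split wq.
have wK : w \notin K by apply: contra wM' => wK; rewrite !inE wK wM.
have sq : sorted e (a :: q) by [].
move: sq; rewrite def_q sorted_cat_cons => /andP[sl1 sl2].
have al1 : a \in rcons l1 w.
  by case: (l1) def_q => [|? ?] [-> _]; rewrite ?mem_head.
have ul2 : u \in w :: l2.
  have -> : u = last a (a :: q) by rewrite /= lq.
  by rewrite def_q last_cat /= mem_last.
have : has (mem K) (rcons l1 w).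
  apply: (side _ w a) => //; last by rewrite mem_rcons mem_head.
  by move=> x xl; rewrite def_q -cat_rcons mem_cat xl.
rewrite has_rcons /= (negPf wK) => /hasP[k /mem_split[q1 [q2 def_l1]] kK].
have : has (mem K) (w :: l2).
  apply: (side _ w u) => //; last exact: mem_head.
  by move=> x xl; rewrite def_q mem_cat xl orbT.
rewrite /= (negPf wK) => /hasP[k' /mem_split[q3 [q4 def_l2]] k'K].
have [|kDk' nkk'] := ch q1 k (q2 ++ w :: q3) k' q4.
  by rewrite def_q def_l1 def_l2 -!catA /= -?catA.
by have := clK k k' kK k'K kDk'; rewrite (negPf (nkk' _)) //; case: (q2).
Qed.

(** Induction on the size of [M]: when a clique [K] cuts [M], keep [K] and one component of the
    rest. That component is chosen so that [a] and [u] both survive. *)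
Lemma exists_atom M a u : a \in M -> u \in M -> a != u -> ~~ e a u ->
  clique_linked M a u ->
  exists M', [/\ M' \subset M, no_clique_cutset M', a \in M' & u \in M'].
Proof.
move: {2}#|M| (leqnn #|M|) => n; elim: n M => [|n IH] M.
  by rewrite leqn0 cards_eq0 => /eqP->; rewrite inE.
move=> ltM aM uM aDu nau linkM.
case: (boolP [exists K, cliqueb K &&
    [exists x in M :\: K, [exists y in M :\: K, ~~ joined (M :\: K) x y]]]); last first.
  move/existsPn => nK; exists M; split=> // K /cliqueP clK x y xMK yMK.
  have := nK K; rewrite clK /= => /exists_inPn/(_ x xMK)/exists_inPn/(_ y yMK).
  by rewrite negbK.
case/existsP=> K /andP[/cliqueP clK] /exists_inP[x xMK /exists_inP[y yMK nxy]].
have reduce F : component (M :\: K) F -> a \in (K :&: M) :|: F -> u \in (K :&: M) :|: F ->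
    exists M', [/\ M' \subset M, no_clique_cutset M', a \in M' & u \in M'].
  move=> Fcomp aF uF; have [FS Fconn _] := Fcomp.
  have subM : (K :&: M) :|: F \subset M.
    by rewrite subUset subsetIr (subset_trans FS) // subsetDl.
  have [||M' [sM' ncM' aM' uM']] := IH _ _ aF uF aDu nau.
  - rewrite -ltnS; apply: leq_trans ltM; apply: proper_card.
    (* If nothing were lost, [F] would contain both [x] and [y], which are not joined outside
       [K]. *)
    rewrite properE subM; apply/negP => /subsetP MF.
    have inF w : w \in M :\: K -> w \in F.
      rewrite inE => /andP[wK wM]; have := MF w wM.
      by rewrite !inE (negPf wK).
    by have := joinedS FS (Fconn _ _ (inF x xMK) (inF y yMK)); rewrite (negPf nxy).
  - exact: clique_linked_sub.
  by exists M'; split=> //; apply: subset_trans subM.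
have aMKE w : w \in M -> w \notin K -> w \in M :\: K by move=> wM wK; rewrite inE wK.
case: (boolP (a \in K)) => aK.
  (* Being non-adjacent, [a] and [u] are not both in the clique. *)
  have uK : u \notin K by apply: contra nau => uK; apply: clK.
  have [F Fcomp uF] := exists_component (aMKE u uM uK).
  by apply: reduce Fcomp _ _; rewrite !inE ?aK ?aM ?uF ?orbT.
have [F Fcomp aF] := exists_component (aMKE a aM aK).
apply: reduce (Fcomp) _ _; rewrite !inE ?aF ?orbT //.
case: (boolP (u \in K)) => uK; first by rewrite uM.
have [_ _ Fcl] := Fcomp.
exact: (joined_closed Fcl (aMKE a aM aK) (linkM K clK aK uK) aF).
Qed.
End Graph.

(** * The separating clique for a paw *)

Theorem theorem4p3 (T : finType) (e : rel T)
    (e_sym : symmetric e) (e_irr : irreflexive e)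
    (e_clock_free : clock_free e) (e_diamond_free : diamond_free e)
    (e_no_star_cutset : forall X : {set T}, ~ star_cutset e X)
    (a a' u v : T) (distinct_vertices : uniq [:: a; a'; u; v])
    (paw : induced_edges e [set a; a'; u; v] =
           [set [set a; a']; [set a; v]; [set a'; v]; [set u; v]]) :
  exists (b : T) (K : {set T}),
    [/\ b \notin nbh e a,
        clique e K,
        K \subset closed_nbh e b,
        [disjoint v |: K & [set u; a; a']] &
        forall (y : T) (p : seq T), y \in [set a; a'] ->
          path_from_to e u y p ->
          exists2 w : T, w \in u :: p & w \in v |: K].
Proof.
have [aDa' aDu aDv] : [/\ a != a', a != u & a != v].
  by move: distinct_vertices; rewrite /= !inE !negb_or => /andP[/and3P[]].
have [a'Du a'Dv uDv] : [/\ a' != u, a' != v & u != v].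
  by move: distinct_vertices; rewrite /= !inE !negb_or => /and4P[_ /andP[]].
have set2_eq (x y z w : T) : [set x; y] = [set z; w] -> x = z /\ y = w \/ x = w /\ y = z.
  move=> xyzw; have mem p : (p \in [set x; y]) = (p \in [set z; w]) by rewrite xyzw.
  have := mem x; have := mem y; have := mem z; have := mem w; rewrite !inE !eqxx ?orbT /=.
  move=> /orP[]/eqP ? /orP[]/eqP ? /esym/orP[]/eqP ? /esym/orP[]/eqP ?; auto.
have edge x y : [set x; y] \in induced_edges e [set a; a'; u; v] -> e x y.
  by case/imset2P=> z w _; rewrite inE => /andP[_ zw] /set2_eq[[-> ->]|[-> ->]]; rewrite // e_sym.
have [aa' va va' uv] : [/\ e a a', e v a, e v a' & e v u].
  by split; apply: edge; rewrite paw !inE ?eqxx ?orbT // setUC eqxx ?orbT.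
have nau : ~~ e a u.
  apply/negP => au; have : [set a; u] \in induced_edges e [set a; a'; u; v].
    by apply: imset2_f; rewrite !inE ?eqxx ?orbT //= au.
  rewrite paw !inE -!orbA => /or4P[] /eqP /set2_eq[] [? ?]; subst;
    by rewrite eqxx in aDa' aDu aDv a'Du a'Dv uDv *.
case: (boolP [exists K, [&& cliqueb e K, a \notin K, u \notin K &
    ~~ joined e (~: (v |: K)) a u]]); last first.
  move/existsPn => noK.
  have [|||M [subM ncM aM uM]] := exists_atom e_sym (M := [set~ v]) _ _ aDu nau.
  - by rewrite !inE.
  - by rewrite !inE.
  - move=> K /cliqueP clK aK uK; have := noK K; rewrite clK aK uK /= negbK.
    by apply: joinedS; rewrite setCU setDE.
  have [C [hC subC uC aC]] := common_hole e_sym e_irr e_clock_free ncM aM uM aDu nau.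
  case: (@clock_center _ e e_clock_free C v a u) => //.
  by apply/negP => /subC /(subsetP subM); rewrite !inE eqxx.
case/existsP=> K /and4P[/cliqueP clK aK uK nau'].
have aX : a \in ~: (v |: K) by rewrite !inE (negPf aDv).
have uX : u \in ~: (v |: K) by rewrite !inE (negPf uDv).
have a'K : a' \notin K.
  apply/negP => a'K; apply: (e_no_star_cutset (v |: K)); split.
    split; first by apply/set0Pn; exists a.
    by move/(_ a u aX uX); apply/negP.
  exists a'; first by rewrite !inE a'K orbT.
  apply/subsetP => x; rewrite !inE => /orP[/eqP->|xK]; first by rewrite e_sym va' orbT.
  by rewrite eq_sym; case: eqP => //= /eqP a'Dx; apply: clK.
have a'X : a' \in ~: (v |: K) by rewrite !inE (negPf a'Dv).
(* A path that avoids [v |: K] would join [u] to [a], if necessary by way of the edge between [a']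
   and [a]. *)
have sep y p : y \in [set a; a'] -> path_from_to e u y p ->
    exists2 w : T, w \in u :: p & w \in v |: K.
  move=> ya [up _ lp]; apply/exists_inP; apply: contraR nau' => /exists_inPn np.
  have ju : joined e (~: (v |: K)) u y.
    rewrite -lp; apply: (joined_path e_sym up); rewrite ?mem_head ?mem_last // => w wp.
    by rewrite in_setC np.
  rewrite joined_sym //; apply: (joined_trans ju).
  move: ya; rewrite !inE => /orP[]/eqP->; first exact: connect0.
  by apply: joined_edge; rewrite // e_sym.
have disj : [disjoint v |: K & [set u; a; a']].
  rewrite -setI_eq0; apply/eqP/setP => x; rewrite !inE.
  apply/negP => /andP[xK]; rewrite -orbA => /or3P[] /eqP def_x; move: xK; rewrite def_x.
  - by rewrite (negPf uDv) (negPf uK).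
  - by rewrite (negPf aDv) (negPf aK).
  - by rewrite (negPf a'Dv) (negPf a'K).
(* If all of [K] is adjacent to [a], in particular if [K] is empty, then [b] is [a], which is not
   its own neighbour. *)
case: (boolP [exists b in K, ~~ e a b]) => [/exists_inP[b bK nab]|/exists_inPn aK'].
  exists b, K; split=> //; first by rewrite inE.
  apply/subsetP => x xK; rewrite !inE eq_sym; case: eqP => //= /eqP bDx.
  exact: clK.
exists a, K; split=> //; first by rewrite inE e_irr.
by apply/subsetP => x /aK'; rewrite negbK !inE => ->; rewrite orbT.
Qed.
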